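(* Let $w^*\in\mathbb{R}\setminus\{0\}$, $\tau_1^{*2},\tau_2^{*2}>0$ and $y\in\mathbb{R}$ with $y^2>0$ and $y^2\neq\tau_2^{*2}$. Put $\sigma_{1,X}^2:=w^{*2}\tau_2^{*2}+\tau_1^{*2}$, $\sigma_{1,Y}^2:=w^{*2}y^2+\tau_1^{*2}$ and, for $\eta\in(0,1)$, $$D_{12}(\eta):=\frac12\log\left(\frac{\eta\,\sigma_{1,X}^2+(1-\eta)\,\sigma_{1,Y}^2}{(\sigma_{1,X}^2)^{\eta}(\tau_1^{*2})^{1-\eta}}\right).$$ Then $D_{12}$ is positive and strictly concave on $(0,1)$. Moreover, if $$\frac{w^{*2}(\tau_2^{*2}-y^2)}{w^{*2}y^2+\tau_1^{*2}}>\log\left(1+\frac{w^{*2}\tau_2^{*2}}{\tau_1^{*2}}\right),$$ then $D_{12}$ achieves a unique maximum at some $\eta^*\in(0,1)$. Otherwise, $D_{12}$ is strictly decreasing on $(0,1)$. *)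

(* Defs.v *)
From mathcomp Require Import all_boot all_order all_algebra.
From mathcomp Require Import all_classical all_reals all_analysis.

Set Implicit Arguments.
Unset Strict Implicit.
Unset Printing Implicit Defensive.

Import Order.TTheory GRing.Theory Num.Theory.

Local Open Scope ring_scope.

Definition strictly_concave_on (R : realType) (I : interval R) (f : R -> R) :
    Prop :=
  forall x y t : R, x \in I -> y \in I -> x != y -> 0 < t < 1 ->
    t * f x + (1 - t) * f y < f (t * x + (1 - t) * y).

Definition is_max_on (R : realType) (I : interval R) (f : R -> R) (m : R) :
    Prop :=
  m \in I /\ {in I, forall x : R, f x <= f m}.

Section D12.
Variables (R : realType) (w tau1 tau2 y : R).

Definition sigma1X2 : R := w ^+ 2 * tau2 ^+ 2 + tau1 ^+ 2.

Definition sigma1Y2 : R := w ^+ 2 * y ^+ 2 + tau1 ^+ 2.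

Definition D12 (eta : R) : R :=
  2^-1 * ln ((eta * sigma1X2 + (1 - eta) * sigma1Y2) /
             (sigma1X2 `^ eta * (tau1 ^+ 2) `^ (1 - eta))).

End D12.

(* Main.v *)
Require Import Defs.
From mathcomp Require Import all_boot all_order all_algebra.
From mathcomp Require Import all_classical all_reals all_analysis.
From mathcomp Require Import ring lra.

Set Implicit Arguments.
Unset Strict Implicit.
Unset Printing Implicit Defensive.

Import Order.TTheory GRing.Theory Num.Theory.

Local Open Scope ring_scope.

(** Write [X], [Y], [T] for sigma1X2, sigma1Y2 and tau1 ^+ 2, so that [T] lies
    strictly below both [X] and [Y], and [X != Y]. Taking the logarithm apart,
    2 * D12 (eta) = ln (eta X + (1 - eta) Y) - eta ln X - (1 - eta) ln T
    is the logarithm of a nonconstant affine function minus an affine function.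
    Call it [g], in the code [log_gap]. Since ln lies strictly below each of
    its tangents ([ln_lt_tangent]), [g] lies, on [0, 1] and away from [s],
    strictly below the line through (s, g(s)) of slope
      g'(s) = (X - Y) / (s X + (1 - s) Y) - ln (X / T)
    ([log_gap_lt_tangent]). These tangent inequalities replace differentiation
    throughout.

    Strict concavity is the chord inequality obtained by averaging the tangent
    inequality at the intermediate point. It holds on the closed interval, where
    g(0) = ln (Y / T) > 0 and g(1) = 0, whence positivity on the open one.

    The hypothesis of the dichotomy says exactly that g'(0) > 0. It forces
    X > Y, so that g' = 0 can be solved for s = (ln (X / T))^-1 - Y / (X - Y).
    This point is positive because g'(0) > 0, and smaller than 1 because
    g'(1) = (1 - Y / X) - ln (X / T) < 0, by T < Y and 1 - Y / X < ln (X / Y);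
    a horizontal strict tangent makes it the unique maximum. If on the contrary
    g'(0) <= 0, then g' <= 0 throughout, and each tangent inequality, read to
    the right of the point of tangency, is a strict decrease. *)

(** This is 1 + l < exp l at l = ln (b / a), which is nonzero. *)
Lemma ln_lt_tangent (R : realType) (a b : R) :
  0 < a -> 0 < b -> b != a -> ln b < ln a + (b - a) / a.
Proof.
move=> a0 b0 ba.
have r0 : 0 < b / a by rewrite divr_gt0.
have l0 : ln (b / a) != 0.
  by rewrite ln_eq0// -[1]divr1 eqr_div ?oner_neq0 ?lt0r_neq0// mulr1 mul1r.
have := expR_gt1Dx l0; rewrite lnK ?posrE// ln_div ?posrE//.
have -> : (b - a) / a = b / a - 1 by field; exact: lt0r_neq0.
lra.
Qed.

(** The slope [c] plays the role of a derivative. Averaging the inequalities of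
    the tangent at [t * x + (1 - t) * y], taken at [x] and at [y], cancels
    [c]. *)
Lemma strictly_concave_on_tangent (R : realType) (a b : R) (f c : R -> R) :
  {in `[a, b] &, forall s x, x != s -> f x < f s + (x - s) * c s} ->
  strictly_concave_on `[a, b] f.
Proof.
move=> tangent x y t xI yI xy /andP[t0 t1].
set s := t * x + (1 - t) * y.
have sI : s \in `[a, b].
  by move: xI yI; rewrite !in_itv /= /s => /andP[? ?] /andP[? ?]; apply/andP; nra.
have xs : x != s.
  rewrite -subr_eq0 (_ : x - s = (1 - t) * (x - y)); last by rewrite /s; ring.
  by rewrite mulf_neq0 ?subr_eq0// gt_eqF.
have ys : y != s.
  rewrite -subr_eq0 (_ : y - s = t * (y - x)); last by rewrite /s; ring.
  by apply: mulf_neq0; [rewrite gt_eqF|rewrite subr_eq0 eq_sym].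
have hx := tangent _ _ sI xI xs; have hy := tangent _ _ sI yI ys.
have {hx} : t * f x < t * (f s + (x - s) * c s) by rewrite ltr_pM2l.
have {hy} : (1 - t) * f y < (1 - t) * (f s + (y - s) * c s).
  by rewrite ltr_pM2l// subr_gt0.
have : t * (f s + (x - s) * c s) + (1 - t) * (f s + (y - s) * c s) = f s.
  by rewrite /s; ring.
lra.
Qed.

Section LogGap.
Variables (R : realType) (X Y T : R).

Definition mix (e : R) : R := e * X + (1 - e) * Y.

Definition log_gap (e : R) : R := ln (mix e) - e * ln X - (1 - e) * ln T.

Definition log_gap_slope (s : R) : R := (X - Y) / mix s - (ln X - ln T).

Hypotheses (X0 : 0 < X) (Y0 : 0 < Y).

Lemma mix_gt0 e : e \in `[0, 1] -> 0 < mix e.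
Proof.
rewrite in_itv /= /mix le_eqVlt => /andP[/predU1P[<- _|e0 e1]].
  by rewrite mul0r subr0 mul1r add0r.
by rewrite ltr_pwDl ?mulr_gt0// mulr_ge0 ?subr_ge0// ltW.
Qed.

Lemma log_gapE e : 0 < T -> e \in `[0, 1] ->
  ln (mix e / (X `^ e * T `^ (1 - e))) = log_gap e.
Proof.
move=> T0 eI; rewrite ln_div ?posrE ?mulr_gt0 ?powR_gt0 ?mix_gt0//.
by rewrite lnM ?posrE ?powR_gt0// !ln_powR /log_gap; ring.
Qed.

Lemma log_gap_lt_tangent : X != Y ->
  {in `[0, 1] &, forall s x, x != s ->
    log_gap x < log_gap s + (x - s) * log_gap_slope s}.
Proof.
move=> XY s x sI xI xs; have s0 := mix_gt0 sI.
have mixB : mix x - mix s = (x - s) * (X - Y) by rewrite /mix; ring.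
have mx : mix x != mix s by rewrite -subr_eq0 mixB mulf_neq0// subr_eq0.
have := ln_lt_tangent s0 (mix_gt0 xI) mx.
rewrite mixB /log_gap /log_gap_slope -mulrA; lra.
Qed.

Lemma log_gap_concave : X != Y -> strictly_concave_on `[0, 1] log_gap.
Proof. by move=> /log_gap_lt_tangent; exact: strictly_concave_on_tangent. Qed.

Hypotheses (T0 : 0 < T) (TX : T < X) (TY : T < Y) (XY : X != Y).

Let L0 : 0 < ln X - ln T.
Proof. by rewrite subr_gt0 ltr_ln. Qed.

(** By strict concavity: the chord over [0, 1] is positive before 1, as it
    starts at ln (Y / T) > 0 and ends at 0. *)
Lemma log_gap_gt0 e : e \in `]0, 1[ -> 0 < log_gap e.
Proof.
rewrite in_itv /= => /andP[e0 e1].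
have I0 : (0 : R) \in `[0, 1] by rewrite in_itv /= lexx ler01.
have I1 : (1 : R) \in `[0, 1] by rewrite in_itv /= lexx ler01.
have e01 : 0 < e < 1 by rewrite e0.
have := log_gap_concave XY I1 I0 (oner_neq0 _) e01.
rewrite mulr1 mulr0 addr0; apply: lt_trans.
have -> : log_gap 1 = 0.
  by rewrite /log_gap /mix subrr !mul0r !mul1r addr0 subr0 subrr.
rewrite mulr0 add0r; apply: mulr_gt0; first by rewrite subr_gt0.
rewrite /log_gap /mix subr0 !mul0r !mul1r add0r subr0 subr_gt0.
by rewrite ltr_ln.
Qed.

(** The slope is positive at 0 and negative at 1, so it vanishes in between;
    a strict tangent that is horizontal bounds [log_gap] by its value there. *)
Lemma log_gap_max : ln X - ln T < (X - Y) / Y ->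
  exists2 s, s \in `]0, 1[ &
    {in `]0, 1[, forall x, x != s -> log_gap x < log_gap s}.
Proof.
move=> slope0.
have XY0 : 0 < X - Y.
  by have := lt_trans L0 slope0; rewrite pmulr_lgt0 ?invr_gt0.
(* The slope is negative at 1; this will give [s < 1]. *)
have L1 : (X - Y) / X < ln X - ln T.
  have := ln_lt_tangent X0 Y0; rewrite eq_sym => /(_ XY).
  have : ln T < ln Y by rewrite ltr_ln.
  rewrite -opprB mulNr; lra.
have Lgt0 := L0; set L := ln X - ln T in Lgt0 slope0 L1 *.
(* [s] solves [mix s = (X - Y) / L], that is, [log_gap_slope s = 0]. *)
pose s := L^-1 - Y / (X - Y).
have mixs : mix s = (X - Y) / L by rewrite /mix /s; field; rewrite !gt_eqF.
have sI : s \in `]0, 1[.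
  rewrite in_itv /=; apply/andP; split.
    rewrite subr_gt0 -[Y / _]invf_div ltf_pV2 ?posrE// divr_gt0//.
  have -> : (1 : R) = X / (X - Y) - Y / (X - Y) by field; rewrite gt_eqF.
  by rewrite ltrD2r -[X / _]invf_div ltf_pV2 ?posrE// divr_gt0.
exists s => // x xI xs.
have sub := subset_itv_oo_cc.
have := log_gap_lt_tangent XY (sub _ _ _ _ _ sI) (sub _ _ _ _ _ xI) xs.
rewrite /log_gap_slope -/L mixs.
by have -> : (X - Y) / ((X - Y) / L) - L = 0; [field; rewrite !gt_eqF|
  rewrite mulr0 addr0].
Qed.

(** The slope is nonpositive everywhere: if X <= Y, both of its terms
    (X - Y) / mix s and - ln (X / T) are; otherwise [mix s > Y], so the slope
    at [s] is below the slope at 0. *)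
Lemma log_gap_decreasing : (X - Y) / Y <= ln X - ln T ->
  {in `]0, 1[ &, {homo log_gap : x y /~ x < y}}.
Proof.
move=> slope0 x s xI sI sx; have sub := subset_itv_oo_cc.
have s0 : 0 < mix s by rewrite mix_gt0// sub.
have := log_gap_lt_tangent XY (sub _ _ _ _ _ sI) (sub _ _ _ _ _ xI).
rewrite gt_eqF// => /(_ isT) /lt_le_trans; apply.
rewrite gerDl; apply: mulr_ge0_le0; first by rewrite subr_ge0 ltW.
rewrite /log_gap_slope subr_le0.
have [XleY|YltX] := leP X Y.
  by rewrite (le_trans _ (ltW L0))// mulr_le0_ge0 ?subr_le0// invr_ge0 ltW.
apply: le_trans slope0; rewrite ler_pM2l ?subr_gt0// lef_pV2 ?posrE//.
by move: sI; rewrite in_itv /= /mix => /andP[? ?]; nra.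
Qed.

End LogGap.

Theorem lemma4p1 (R : realType) (w tau1 tau2 y : R)
    (hw : w != 0) (htau1 : 0 < tau1 ^+ 2) (htau2 : 0 < tau2 ^+ 2)
    (hy : 0 < y ^+ 2) (hytau2 : y ^+ 2 != tau2 ^+ 2) :
  [/\ {in `]0, 1[, forall eta : R, 0 < D12 w tau1 tau2 y eta},
      strictly_concave_on `]0, 1[ (D12 w tau1 tau2 y),
      w ^+ 2 * (tau2 ^+ 2 - y ^+ 2) / (w ^+ 2 * y ^+ 2 + tau1 ^+ 2) >
        ln (1 + w ^+ 2 * tau2 ^+ 2 / tau1 ^+ 2) ->
      exists! etas : R, is_max_on `]0, 1[ (D12 w tau1 tau2 y) etas
    & ~ (w ^+ 2 * (tau2 ^+ 2 - y ^+ 2) / (w ^+ 2 * y ^+ 2 + tau1 ^+ 2) >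
           ln (1 + w ^+ 2 * tau2 ^+ 2 / tau1 ^+ 2)) ->
      {in `]0, 1[ &, {homo D12 w tau1 tau2 y : eta1 eta2 /~ eta1 < eta2}}].
Proof.
have w0 : 0 < w ^+ 2 by rewrite exprn_even_gt0.
set X := sigma1X2 w tau1 tau2; set Y := sigma1Y2 w tau1 y.
set T := tau1 ^+ 2.
have TX : T < X by rewrite /X /sigma1X2 ltrDr mulr_gt0.
have TY : T < Y by rewrite /Y /sigma1Y2 ltrDr mulr_gt0.
have X0 : 0 < X := lt_trans htau1 TX.
have Y0 : 0 < Y := lt_trans htau1 TY.
have XBY : X - Y = w ^+ 2 * (tau2 ^+ 2 - y ^+ 2).
  by rewrite /X /Y /sigma1X2 /sigma1Y2; ring.
have XY : X != Y.
  rewrite -subr_eq0 XBY; apply: mulf_neq0; first by rewrite gt_eqF.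
  by rewrite subr_eq0 eq_sym.
have lnXT : ln (1 + w ^+ 2 * tau2 ^+ 2 / T) = ln X - ln T.
  rewrite -ln_div ?posrE//; congr ln.
  by rewrite /X /sigma1X2 -/T; field; rewrite gt_eqF.
have D12E e : e \in `]0, 1[ -> D12 w tau1 tau2 y e = 2^-1 * log_gap X Y T e.
  by move=> eI; rewrite -log_gapE// subset_itv_oo_cc.
have half0 : 0 < 2^-1 :> R by rewrite invr_gt0.
rewrite lnXT -XBY -/Y; split.
- by move=> e eI; rewrite D12E// mulr_gt0// log_gap_gt0.
- move=> x z t xI zI xz t01.
  have sI : t * x + (1 - t) * z \in `]0, 1[.
    move: xI zI t01; rewrite !in_itv /= => /andP[? ?] /andP[? ?] /andP[? ?].
    by apply/andP; nra.
  have := log_gap_concave T X0 Y0 XY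
    (subset_itv_oo_cc xI) (subset_itv_oo_cc zI) xz t01.
  rewrite !D12E//; lra.
- move=> /(log_gap_max X0 Y0 htau1 TX TY XY)[s sI smax].
  have Dmax x : x \in `]0, 1[ -> x != s ->
      D12 w tau1 tau2 y x < D12 w tau1 tau2 y s.
    by move=> xI xs; rewrite !D12E// ltr_pM2l// smax.
  exists s; split.
    split=> // x xI; have [->//|xs] := eqVneq x s.
    by rewrite ltW// Dmax.
  move=> s' [s'I s'max]; apply/eqP; rewrite eq_sym; apply/negPn/negP => s's.
  by have := lt_le_trans (Dmax _ s'I s's) (s'max _ sI); rewrite ltxx.
- move=> /negP; rewrite -leNgt.
  move=> /(log_gap_decreasing X0 Y0 htau1 TX XY) decr x z xI zI zx.
  by rewrite !D12E// ltr_pM2l// decr.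
Qed.
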